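(* Let $G$ be a semigroup and let $\sqsubset$ be a binary relation on $G$ such that $G$ is $\sqsubset\cdot$-closed and $\sqsubset$-covered. Then for every finite coloring of $G$ there is a $\sqsubset$-chain $\bar a=\langle a_i:i<\omega\rangle$ of elements of $G$ such that $\mathrm{fp}\,\bar a$ is monochromatic. If moreover there is no $g\in G$ such that $h\sqsubset g$ for all $h\in G$, then $\bar a$ may in addition be chosen with all its elements distinct.
   Context: For a binary relation $\sqsubset$ on $G$: $G$ is $\sqsubset$-covered if for every finite $A\subseteq G$ there is $c\in G$ with $a\sqsubset c$ for all $a\in A$; $G$ is $\sqsubset\cdot$-closed if $a\sqsubset b\sqsubset c$ implies $a\sqsubset b\cdot c$ for all $a,b,c\in G$. A $\sqsubset$-chain is a sequence $\bar a$ with $a_i\sqsubset a_{i+1}$ for all $i$. For a tuple $\bar a$, $\mathrm{fp}\,\bar a$ is the set of all finite products $a_{i_0}\cdot a_{i_1}\cdots a_{i_k}$ with $i_0<i_1<\dots<i_k<|\bar a|$. A finite coloring of $G$ is a map $G\to\{1,\dots,k\}$; a subset is monochromatic if the map is constant on it. *)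

(* Defs.v *)
From HB Require Import structures.
From mathcomp Require Import all_boot.
From mathcomp Require Import classical_sets.

Set Implicit Arguments.
Unset Strict Implicit.
Unset Printing Implicit Defensive.

Local Open Scope group_scope.
Local Open Scope classical_set_scope.

(* Finite subsets of T are given by their lists of elements. *)
Definition rel_covered (T : eqType) (R : T -> T -> Prop) : Prop :=
  forall A : seq T, exists c : T, {in A, forall a, R a c}.

Definition rel_mul_closed (G : magmaType) (R : G -> G -> Prop) : Prop :=
  forall a b c : G, R a b -> R b c -> R a (b * c).

Definition rel_chain (T : Type) (R : T -> T -> Prop) (a : nat -> T) : Prop :=
  forall i : nat, R (a i) (a i.+1).

(* A semigroup has no neutral element, so the nonempty product
   a i0 * a i1 * .. * a ik, with indices i0 :: [:: i1; ..; ik], is folded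
   from the left starting at its first factor. *)
Definition seq_prod (G : magmaType) (a : nat -> G) (i0 : nat) (s : seq nat) : G :=
  foldl (fun x i => x * a i) (a i0) s.

Definition fp (G : magmaType) (a : nat -> G) : set G :=
  [set x | exists (i0 : nat) (s : seq nat),
             path ltn i0 s /\ x = seq_prod a i0 s].

Definition monochromatic (T C : Type) (col : T -> C) (S : set T) : Prop :=
  forall x y : T, S x -> S y -> col x = col y.

(* Main.v *)
Require Import Defs.
From HB Require Import structures.
From mathcomp Require Import all_boot.
From mathcomp Require Import classical_sets.
From mathcomp Require Import boolp filter.

(** By Ellis-Numakura and Galvin-Glazer: the ultrafilters on [G] containing all
  the sets [{c | a R c}] exist because [G] is covered, and they form a closed
  subsemigroup of the Stone-Cech compactification because [a R b R c] implies
  [a R b * c]; hence one of them, [V], is idempotent.  A colour class lies in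
  [V], and the usual greedy choice yields a sequence with all its finite
  products in that class, where each term can moreover be taken in any
  prescribed [V]-large set depending on the previous terms, in particular
  among the [R]-successors of the last term.  If no element is [R]-above all
  others then [V] is not principal, so previous terms can be avoided.

  Closed subsemigroups are represented by filters [F] that are included in
  [F * F], and a minimal closed subsemigroup by a maximal such filter. *)

Set Implicit Arguments.
Unset Strict Implicit.
Unset Printing Implicit Defensive.

Local Open Scope group_scope.
Local Open Scope classical_set_scope.

Section FilterProduct.
Variable G : semigroupType.
Implicit Types (F V : set_system G) (A B : set G).

(* [{x | x^-1 A \in V}], where [x^-1 A = {y | x * y \in A}]. *)
Definition shift_in V A : set G := [set x | V [set y | A (x * y)]].

Definition filter_mul F V : set_system G := [set A | F (shift_in V A)].

Definition subidempotent F := F `<=` filter_mul F F.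

Lemma shift_inS V A B : Filter V -> A `<=` B -> shift_in V A `<=` shift_in V B.
Proof. by move=> FV AB x; apply: filterS => y; apply: AB. Qed.

Lemma shift_inI V A B : Filter V ->
  shift_in V A `&` shift_in V B `<=` shift_in V (A `&` B).
Proof. by move=> FV x [xA xB]; exact: filterI. Qed.

Lemma filter_mul_filter F V : Filter F -> Filter V -> Filter (filter_mul F V).
Proof.
move=> FF FV; split.
- by apply: (@filterS _ F _ _ _ _ filterT) => x _; exact: filterT.
- move=> A B FA FB; apply: (@filterS _ F _ _ _ _ (@filterI _ F _ _ _ FA FB)).
  exact: shift_inI.
- by move=> A B AB; apply: (@filterS _ F); exact: shift_inS.
Qed.

Lemma filter_mul_proper F V :
  ProperFilter F -> ProperFilter V -> ProperFilter (filter_mul F V).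
Proof.
move=> PF PV; split; last exact: filter_mul_filter.
by move=> /(@filter_ex _ F _)[x] /filter_ex[].
Qed.

Lemma filter_mulS F F' V V' : Filter F ->
  F `<=` F' -> V `<=` V' -> filter_mul F V `<=` filter_mul F' V'.
Proof. by move=> FF FF' VV' A FA; apply/FF'; apply: (@filterS _ F _ _ _ _ FA) => x /VV'. Qed.

(** [F * V] lies in [F * F * F * V], whose middle [F] may be enlarged to [V]. In terms of
    ultrafilters: if [S] is a closed subsemigroup and [p] is in [S], then [S * p] is closed under
    products. *)
Lemma subidempotent_filter_mul F V : Filter F -> Filter V ->
  F `<=` V -> subidempotent F -> subidempotent (filter_mul F V).
Proof.
move=> FF FV FsubV idF A /idF; apply: (@filterS _ F) => x1 /idF Fx1.
apply/FsubV; apply: (@filterS _ F _ _ _ _ Fx1) => x2.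
apply: (@filterS _ F) => x3; apply: (@filterS _ V) => y.
by rewrite /= !mulgA.
Qed.

Lemma maximal_subidempotent F : ProperFilter F -> subidempotent F ->
  exists M, [/\ ProperFilter M, subidempotent M, F `<=` M &
    forall N, ProperFilter N -> subidempotent N -> M `<=` N -> N = M].
Proof.
move=> PF idF.
pose good N := [/\ ProperFilter N, subidempotent N & F `<=` N].
(* [Zorn_bigcup] also requires an upper bound of the empty chain. *)
have [C Ctot|M [[M0|[PM idM FM]] maxM]] :=
    @Zorn_bigcup (set G) [set N | N = set0 \/ good N].
- have [[N0 [CN0 gN0]]|noN] := pselect (exists N, C N /\ good N); last first.
    left; apply/seteqP; split=> // A [N CN NA].
    by have [N0|gN] := Ctot _ CN; [move: NA; rewrite N0|case: noN; exists N].
  have goodC N A : C N -> N A -> good N by case/Ctot => // ->.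
  move=> Clin; right; have [PN0 idN0 FN0] := gN0.
  split; last by move=> A FA; exists N0 => //; exact: FN0.
  + split; first by move=> [N CN N0']; have [[]] := goodC _ _ CN N0'.
    split; first by exists N0 => //; exact: filterT.
    * move=> A B [N CN NA] [N' CN' NB].
      have [[PN _ _] [PN' _ _]] := (goodC _ _ CN NA, goodC _ _ CN' NB).
      have [NN'|N'N] := Clin _ _ CN CN'.
        by exists N' => //; apply: filterI => //; exact: NN'.
      by exists N => //; apply: filterI => //; exact: N'N.
    * move=> A B AB [N CN NA]; have [PN _ _] := goodC _ _ CN NA.
      by exists N => //; exact: filterS NA.
  + move=> A [N CN NA]; have [PN idN _] := goodC _ _ CN NA.
    exists N => //; apply: (@filterS _ N _ _ _ _ (idN _ NA)) => x Nx.
    by exists N.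
- case: (maxM F); last by right; split.
  split; first by rewrite M0.
  by move=> /(_ setT filterT); rewrite M0.
- exists M; split=> // N PN idN MN; apply/seteqP; split=> //.
  apply: contrapT => nNM; apply: (maxM N); first by split.
  by right; split=> //; exact: subset_trans MN.
Qed.

Lemma idempotent_ultrafilter F : ProperFilter F -> subidempotent F ->
  exists V, [/\ UltraFilter V, subidempotent V & F `<=` V].
Proof.
move=> PF /(maximal_subidempotent PF)[M [PM idM FM maxM]].
have [V [UV MV]] := ultraFilterLemma PM.
have mulMV : filter_mul M V = M.
  apply: maxM; first exact: filter_mul_proper.
    exact: subidempotent_filter_mul.
  by apply: subset_trans idM _; exact: filter_mulS.
(* In terms of ultrafilters, [T] stands for [{p \in M | p * V = V}]. *)
pose T : set_system G :=
  [set B | exists m A, [/\ M m, V A & m `&` shift_in V A `<=` B]].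
have MT : M `<=` T.
  by move=> m Mm; exists m, setT; split=> //; exact: filterT.
have VT A : V A -> T (shift_in V A).
  by move=> VA; exists setT, A; split=> //; exact: filterT.
have PT : ProperFilter T.
  split; last split.
  (* Were [m] and [shift_in V A] disjoint, the complement of [A] would lie in [M * V = M], hence in
     [V] together with [A]. *)
  - move=> [m [A [Mm VA mA0]]].
    have : filter_mul M V (~` A).
      apply: (@filterS _ M _ _ _ _ Mm) => x mx.
      have [|//] := in_ultra_setVsetC [set y | A (x * y)] UV.
      by move=> VxA; case: (mA0 x).
    rewrite mulMV => /MV /(filterI VA); rewrite setICr.
    exact: filter_not_empty.
  - by apply: MT; exact: filterT.
  - move=> B B' [m [A [Mm VA mAB]]] [m' [A' [Mm' VA' mAB']]].
    exists (m `&` m'), (A `&` A'); split; [exact: filterI|exact: filterI|].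
    move=> x [[mx m'x] AA'x]; split.
      by apply: mAB; split=> //; apply: shift_inS AA'x => y [].
    by apply: mAB'; split=> //; apply: shift_inS AA'x => y [].
  - move=> B B' BB' [m [A [Mm VA mAB]]]; exists m, A; split=> //.
    exact: subset_trans BB'.
have idT : subidempotent T.
  have FTT : Filter (filter_mul T T) by exact: filter_mul_filter.
  move=> B [m [A [Mm VA mAB]]]; apply: (filterS mAB); apply: filterI.
    by apply: (@filter_mulS M T M T) => //; exact: idM.
  (* This reflects that [p * V = V] and [q * V = V] give [p * q * V = V]. *)
  apply: (@filterS _ T _ _ _ _ (VT _ VA)) => x /VT.
  apply: (@filterS _ T) => y; apply: (@filterS _ V) => z.
  by rewrite /= mulgA.
have TM : T = M by exact: maxM.
(* For [A] in [V], [shift_in V A] is in [T = M], which puts [A] in [M * V = M]. So [M] is itself an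
   ultrafilter. *)
have VM : V = M.
  apply/seteqP; split=> // A /VT; rewrite TM => MVA.
  by rewrite -mulMV.
by exists M; split=> //; rewrite -VM.
Qed.

Lemma fp_sequence V A (E : G -> set G) :
    ProperFilter V -> subidempotent V -> V A -> (forall x, V (E x)) ->
  exists a : nat -> G,
    fp a `<=` A /\ forall i j, i < j -> E (a i) (a j).
Proof.
move=> PV idV VA VE.
(* Keeping [V B] under the existential lets [choice] produce a function on all sets. *)
have next B : exists x, V B -> B x /\ V [set y | B (x * y)].
  have [VB|nVB] := pselect (V B); last by have [x _] := filter_ex VA; exists x.
  have /filter_ex[x] : V (B `&` shift_in V B) by apply: filterI => //; exact: idV.
  by exists x.
have [f fP] := choice next.
(* The point of the first two conditions is that [a n * y] is in [B n] for every [y] in [B n.+1]. *)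
pose step B := B `&` [set y | B (f B * y)] `&` E (f B).
pose B n := iter n step A; pose a n := f (B n).
have VB n : V (B n).
  elim: n => //= n VBn; have [_ Vn] := fP _ VBn.
  by apply: filterI => //; exact: filterI.
have Ba n : B n (a n) by have [] := fP _ (VB n).
have BS m n : m <= n -> B n `<=` B m.
  by move=> /subnK <-; elim: (n - m) => // d IH x [[/IH]].
exists a; split=> [_ [i [s [i_s ->]]]|i j /BS/(_ _ (Ba j))[]//].
(* Products are folded from the left, whereas the induction below splits off the first factor. *)
have fold x y r : foldl (fun u j => u * a j) (x * y) r =
    x * foldl (fun u j => u * a j) y r.
  by elim: r x y => [//|j r IH] x y /=; rewrite -mulgA IH.
(* The tail of the product, with first index [j > i], lies in [B j] and hence in [B i.+1]. *)
suff : B i (seq_prod a i s) by exact: (BS 0 i (leq0n i)).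
elim: s i i_s => [|j s IH] i /=; first by move=> _; exact: Ba.
by case/andP=> /BS ij /IH /ij[[_ Bij] _]; rewrite /seq_prod /= fold.
Qed.

End FilterProduct.

Lemma ultrafilter_colour (T : Type) (I : finType) (V : set_system T)
    (col : T -> I) : UltraFilter V -> exists c, V [set x | col x = c].
Proof.
move=> UV; apply: contrapT => noc.
have /filter_ex[x] : V [set x | forall c, col x <> c].
  apply: filter_forall => c.
  have [Vc|//] := in_ultra_setVsetC [set x | col x = c] UV.
  by case: noc; exists c.
by move=> /(_ (col x)).
Qed.

Section UpperBoundFilter.
Variables (G : semigroupType) (R : G -> G -> Prop).

Definition upper_bound_filter : set_system G :=
  [set B | exists A : seq G, [set c | {in A, forall a, R a c}] `<=` B].

Lemma upper_bound_filter_proper :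
  rel_covered R -> ProperFilter upper_bound_filter.
Proof.
move=> Rcov; split; last split.
- by move=> [A A0]; have [c /A0] := Rcov A.
- by exists [::].
- move=> B B' [A AB] [A' AB']; exists (A ++ A') => c Ac.
  split; [apply: AB|apply: AB'] => a aA; apply: Ac.
    by rewrite mem_cat aA.
  by rewrite mem_cat aA orbT.
- by move=> B B' BB' [A AB]; exists A; exact: subset_trans BB'.
Qed.

(** If [x] is above all of [A], then so is [x * y] whenever [R x y]; the inner finite set is thus
    [[:: x]]. *)
Lemma upper_bound_filter_subidempotent :
  rel_mul_closed R -> subidempotent upper_bound_filter.
Proof.
move=> Rmul B [A AB]; exists A => x Ax; exists [:: x] => y xy.
by apply: AB => a aA; apply: Rmul (Ax _ aA) (xy _ _); rewrite inE.
Qed.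

End UpperBoundFilter.

Theorem theorem5p1 (G : semigroupType) (R : G -> G -> Prop)
    (Rclosed : rel_mul_closed R) (Rcovered : rel_covered R)
    (k : nat) (col : G -> 'I_k) :
  (exists a : nat -> G, rel_chain R a /\ monochromatic col (fp a)) /\
  ((~ exists g : G, forall h : G, R h g) ->
   exists a : nat -> G,
     [/\ rel_chain R a, monochromatic col (fp a) & injective a]).
Proof.
have [V [UV idV FV]] := idempotent_ultrafilter
  (upper_bound_filter_proper Rcovered) (upper_bound_filter_subidempotent Rclosed).
have VR g : V (R g).
  by apply: FV; exists [:: g] => c; apply; rewrite inE.
have [c Vc] := ultrafilter_colour col UV.
have mono a : fp a `<=` [set x | col x = c] -> monochromatic col (fp a).
  by move=> ac x y /ac -> /ac ->.
split=> [|nomax].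
  have [a [ac aR]] := fp_sequence _ idV Vc VR.
  by exists a; split; [move=> i; exact: aR|exact: mono].
(* If [V] contained [[set g]], this set would meet every [R h], so that [R h g] for all [h]. *)
have VN g : V (R g `&` ~` [set g]).
  apply: filterI => //.
  have [Vg|//] := in_ultra_setVsetC [set g] UV.
  case: nomax; exists g => h.
  have /filter_ex[x [Rhx xg]] : V (R h `&` [set g]) by exact: filterI.
  by rewrite -xg.
have [a [ac aR]] := fp_sequence _ idV Vc VN.
exists a; split; [by move=> i; have [] := aR i i.+1|exact: mono|].
move=> i j aij; have [ij|ji|//] := ltngtP i j.
  by have [_ []] := aR _ _ ij.
by have [_ []] := aR _ _ ji.
Qed.
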